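(* Let $\mathbf X$ be a finite dimensional Hilbert space, $\psi:\mathbf X\to\mathbf X$ a differentiable mapping and $f:\mathbf X\to[-\infty,\infty]$ a proper function, and let $G(x)=\psi(x)+\partial f(x)$ for $x\in\mathbf X$. Assume that $\bar x$ satisfies $0\in\psi(\bar x)+\partial f(\bar x)$, that $\psi$ is strictly differentiable at $\bar x$, that $f$ is prox-regular and subdifferentially continuous at $\bar x$ for $\bar v:=-\psi(\bar x)$, and that $\partial f$ is strictly proto-differentiable at $\bar x$ for $\bar v$. Then the mapping $G$ is metrically regular at $\bar x$ for $0$ if and only if it is strongly metrically regular at $\bar x$ for $0$.
   Context: Set limits are in the Painlevé–Kuratowski sense. For a set $\Omega$ and $x\in\Omega$: $T_\Omega(x)=\limsup_{t\searrow0}\frac{\Omega-x}{t}$ (tangent cone), $\widehat T_\Omega(x)=\liminf_{x'\to x,\,x'\in\Omega,\,t\searrow0}\frac{\Omega-x'}{t}$ (regular tangent cone), $\widetilde T_\Omega(x)=\limsup_{x'\to x,\,x'\in\Omega,\,t\searrow0}\frac{\Omega-x'}{t}$ (paratingent cone). The regular normal cone is the polar $\widehat N_\Omega(x)=T_\Omega(x)^*$; the limiting normal cone $N_\Omega(\bar x)$ consists of limits of $v^k\in\widehat N_\Omega(x^k)$ with $x^k\to\bar x$, $x^k\in\Omega$. For $f$ with $f(\bar x)$ finite, $\partial f(\bar x)=\{v\mid(v,-1)\in N_{\mathrm{epi}f}(\bar x,f(\bar x))\}$. $f$ is prox-regular at $\bar x$ for $\bar v$ if $f$ is finite at $\bar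 x$, locally lower semicontinuous around $\bar x$, $\bar v\in\partial f(\bar x)$, and there exist $\varepsilon>0$, $r\ge0$ such that $f(x')\ge f(x)+\langle v,x'-x\rangle-\frac r2\|x'-x\|^2$ for all $x'$ with $\|x'-\bar x\|\le\varepsilon$ whenever $v\in\partial f(x)$, $\|(x,v)-(\bar x,\bar v)\|\le\varepsilon$ and $f(x)<f(\bar x)+\varepsilon$. $f$ is subdifferentially continuous at $\bar x$ for $\bar v$ if $(x^k,v^k)\to(\bar x,\bar v)$ with $v^k\in\partial f(x^k)$ implies $f(x^k)\to f(\bar x)$. A set-valued mapping $F$ is strictly proto-differentiable at $x$ for $y\in F(x)$ if $\widehat T_{\mathrm{gph}F}(x,y)=\widetilde T_{\mathrm{gph}F}(x,y)$. $F$ is metrically regular at $\bar x$ for $\bar y\in F(\bar x)$ if there exist $\kappa>0$ and neighborhoods $U$ of $\bar x$, $V$ of $\bar y$ with $\mathrm{dist}(x,F^{-1}(y))\le\kappa\,\mathrm{dist}(y,F(x))$ for all $(x,y)\in U\times V$. $F$ is strongly metrically regular at $\bar x$ for $\bar y$ if there exist neighborhoods $U$ of $\bar x$ and $V$ of $\bar y$ such that $y\mapsto F^{-1}(y)\cap U$ is single-valued and Lipschitz continuous on $V$. *)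

(* Defs.v *)
From HB Require Import structures.
From mathcomp Require Import all_boot all_order all_algebra.
From mathcomp Require Import all_classical all_reals all_analysis.

Set Implicit Arguments.
Unset Strict Implicit.
Unset Printing Implicit Defensive.

Import Order.TTheory GRing.Theory Num.Theory.
Import numFieldNormedType.Exports.

Local Open Scope classical_set_scope.
Local Open Scope ring_scope.

(* A normed space that is finite dimensional; it becomes a finite dimensional
   Hilbert space once its norm comes from a [{dot X for idfun}]. *)
#[short(type="normedVectType")]
HB.structure Definition NormedVector (R : realType) :=
  {X of NormedModule R X & Vector R X}.

Section SetLimits.
Context {R : realType} {V : normedModType R} {T : Type}.
Implicit Types (F : set_system T) (S : T -> set V).

(* Painleve-Kuratowski outer and inner limits of [S t] as [t] tends along the
   filter [F], in terms of sequences. *)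
Definition outer_limit F S : set V :=
  [set w | exists (t : nat -> T) (u : nat -> V),
    [/\ t @ \oo `=>` F, forall k, S (t k) (u k) & u @ \oo --> w]].

Definition inner_limit F S : set V :=
  [set w | forall t : nat -> T, t @ \oo `=>` F ->
    exists u : nat -> V, (\forall k \near \oo, S (t k) (u k)) /\ u @ \oo --> w].

End SetLimits.

Section Cones.
Context {R : realType} {V : normedModType R}.
Implicit Types (Omega K : set V) (x : V) (form : V -> V -> R).

Definition difference_quotient Omega x (t : R) : set V :=
  [set t^-1 *: (z - x) | z in Omega].

Definition tangent_cone Omega x : set V :=
  outer_limit 0^'+ (difference_quotient Omega x).

Definition regular_tangent_cone Omega x : set V :=
  inner_limit (filter_prod (within Omega (nbhs x)) 0^'+)
    (fun p : V * R => difference_quotient Omega p.1 p.2).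

Definition paratingent_cone Omega x : set V :=
  outer_limit (filter_prod (within Omega (nbhs x)) 0^'+)
    (fun p : V * R => difference_quotient Omega p.1 p.2).

(* The inner product is a parameter because the library norm of a product
   space, the maximum norm, is not the Hilbert norm. *)
Definition polar form K : set V := [set v | forall w, K w -> form v w <= 0].

Definition regular_normal_cone form Omega x : set V :=
  polar form (tangent_cone Omega x).

Definition limiting_normal_cone form Omega x : set V :=
  [set v | exists xk vk : nat -> V,
    [/\ forall k, Omega (xk k), xk @ \oo --> x,
        forall k, regular_normal_cone form Omega (xk k) (vk k)
      & vk @ \oo --> v]].

End Cones.

Section Functions.
Context {R : realType} {X : normedVectType R} (ip : {dot X for idfun}).
Implicit Types (f : X -> \bar R) (x v : X).
Local Open Scope ereal_scope.

Definition proper_function f : Prop :=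
  (forall x, f x != -oo) /\ (exists x, f x != +oo).

Definition epigraph f : set (X * R) := [set p | f p.1 <= p.2%:E].

Definition ip_prod (p q : X * R) : R := (ip p.1 q.1 + p.2 * q.2)%R.

(* Empty at points where [f] is not finite. *)
Definition subdifferential f x : set X :=
  [set v | f x \is a fin_num /\
    limiting_normal_cone ip_prod (epigraph f) (x, fine (f x)) (v, (-1)%R)].

(* Local lower semicontinuity at a point of finiteness in the sense of
   Rockafellar and Wets: the epigraph of [f] is closed near [(xb, f xb)].
   It is implied by lower semicontinuity at all points near [xb]. *)
Definition locally_lsc f (xb : X) : Prop :=
  exists2 e : R, (0 < e)%R & forall a : R, a%:E <= f xb + e%:E ->
    closed [set x | (`|x - xb| <= e)%R /\ f x <= a%:E].

(* Pairs are measured with the maximum norm, which is equivalent to the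
   Hilbert norm and hence immaterial under the quantifier on [e]. *)
Definition prox_regular f (xb vb : X) : Prop :=
  [/\ f xb \is a fin_num, locally_lsc f xb, subdifferential f xb vb &
    exists e r : R, [/\ (0 < e)%R, (0 <= r)%R &
      forall x v x', subdifferential f x v ->
        (`|(x, v) - (xb, vb)| <= e)%R -> f x < f xb + e%:E ->
        (`|x' - xb| <= e)%R ->
        f x + (ip v (x' - x) - r / 2 * `|x' - x| ^+ 2)%R%:E <= f x']].

Definition subdifferentially_continuous f (xb vb : X) : Prop :=
  forall xk vk : nat -> X,
    (forall k, subdifferential f (xk k) (vk k)) ->
    xk @ \oo --> xb -> vk @ \oo --> vb -> f (xk k) @[k --> \oo] --> f xb.

End Functions.

Definition strictly_differentiable {R : realType} {V W : normedModType R}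
    (psi : V -> W) (xb : V) : Prop :=
  differentiable psi xb /\
  forall e : R, 0 < e -> \forall p \near (nbhs xb, nbhs xb),
    `|psi p.1 - psi p.2 - 'd psi xb (p.1 - p.2)| <= e * `|p.1 - p.2|.

Section SetValuedMappings.
Context {R : realType} {V W : normedModType R}.
Implicit Types F : V -> set W.

Definition gph F : set (V * W) := [set p | F p.1 p.2].

Definition setval_inv F (y : W) : set V := [set x | F x y].

Definition strictly_proto_differentiable F (x : V) (y : W) : Prop :=
  F x y /\ regular_tangent_cone (gph F) (x, y) = paratingent_cone (gph F) (x, y).

Definition metrically_regular F (xb : V) (yb : W) : Prop :=
  F xb yb /\
  exists (kappa : R) (U : set V) (N : set W),
    [/\ 0 < kappa, nbhs xb U, nbhs yb N &
      forall x y, U x -> N y ->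
        (edist_inf (setval_inv F y) x <= kappa%:E * edist_inf (F x) y)%E].

Definition strongly_metrically_regular F (xb : V) (yb : W) : Prop :=
  F xb yb /\
  exists (U : set V) (N : set W) (s : W -> V),
    [/\ nbhs xb U, nbhs yb N,
        forall y, N y -> setval_inv F y `&` U = [set s y]
      & [lipschitz s y | y in N]].

End SetValuedMappings.

(* Main.v *)
From HB Require Import structures.
Require Import Defs.
From mathcomp Require Import all_boot all_order all_algebra.
From mathcomp Require Import all_classical all_reals all_analysis.
From mathcomp Require Import ring lra.

Set Implicit Arguments.
Unset Strict Implicit.
Unset Printing Implicit Defensive.

Import Order.TTheory GRing.Theory Num.Theory.
Import numFieldNormedType.Exports.

Local Open Scope classical_set_scope.
Local Open Scope ring_scope.

(** Strong metric regularity always implies metric regularity: near the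
    reference point a Lipschitz localization [s] of the inverse bounds the
    distance to the inverse image of [y] by the distance to [s y]
    ([strongly_metrically_regularW]).

    The converse is a dimension count in the paratingent cone [L] of the graph
    of the subdifferential at [(xb, - psi xb)].
    - The regular tangent cone is convex and the paratingent cone is symmetric,
      so strict proto-differentiability makes [L] a linear subspace
      ([regular_eq_paratingent_linear]).
    - Prox-regularity and subdifferential continuity make the subdifferential
      hypomonotone near the reference point, and this passes to the limit:
      [ip w u >= - r |u|^2] on [L] ([prox_regular_paratingent]).  Hence, for
      [c = 1 / (r + 1)], the map [(u, w) |-> u + c w] is injective on [L], so
      that [L] has at most the dimension of [X].  This is Minty's
      parametrization of the graph, used only infinitesimally.
    - Let [D] be the derivative of [psi] at [xb].  Strict differentiability
      turns a paratingent direction [(u, e)] of the graph of [G] into the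
      element [(u, e - D u)] of [L] ([paratingent_cone_gph_add]).  Metric
      regularity solves [G x = t e] with a solution at distance [O(t)] from
      [xb]; rescaling and extracting a convergent subsequence shows that
      [(u, w) |-> D u + w] maps [L] onto [X] ([solvable_paratingent_onto]).

    A linear map from a space of dimension at most that of [X] onto [X] is
    injective ([subspace_kernel_trivial]).  So the paratingent cone of the graph
    of [G] contains no [(d, 0)] with [d <> 0], and a compactness argument turns
    this into a Lipschitz estimate for the inverse of [G] near the reference
    point ([paratingent_kernel_lipschitz]).  Together with the solvability
    given by metric regularity, this is strong metric regularity. *)

(** * Compactness in finite dimension *)

(** The coordinate norm is a second norm on [X]: on its unit sphere, which is
    compact, the norm of [X] is bounded below by some [c > 0], so a ball of [X]
    lies in the image of a compact coordinate ball. *)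
Lemma closed_ball_sub_compact (R : realType) (X : normedVectType R) (M : R) :
  exists2 K : set X, compact K & forall x : X, `|x| <= M -> K x.
Proof.
pose n := \dim {:X}; pose b : n.-tuple X := vbasis {:X}.
pose comb (v : 'rV[R]_n) : X := \sum_(i < n) v ord0 i *: b`_i.
pose crd (x : X) : 'rV[R]_n := \row_i coord b i x.
have crdK x : comb (crd x) = x.
  rewrite [RHS](coord_vbasis (memvf x)).
  by apply: eq_bigr => i _; rewrite mxE.
have combK v : crd (comb v) = v.
  by apply/rowP => i; rewrite mxE coord_sum_free// (basis_free (vbasisP _)).
have comb_cont : continuous comb.
  apply: continuous_big => [|i _ v]; first exact: add_continuous.
  exact: (@cvgZr_tmp _ _ _ _ (@nbhs_filter _ v) _ _ _ (@coord_continuous R 1 n ord0 i v)).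
have cptB (B : set R) : closed B -> (exists N : R, B `<=` [set r | r <= N]) ->
    compact [set v : 'rV[R]_n | B `|v|].
  move=> Bcl [N BN]; apply: bounded_closed_compact.
    exists N; split => [|N' NN' v /= /BN]; first exact: num_real.
    by move=> /le_trans; apply; exact: ltW.
  by apply: (@closed_comp _ _ (fun v : 'rV[R]_n => `|v|)) => // v _;
    exact: norm_continuous.
have cptI (A : set 'rV[R]_n) : compact A -> compact (comb @` A).
  move=> cA; apply: continuous_compact => //.
  by apply: continuous_subspaceT; exact: comb_cont.
pose S := comb @` [set v : 'rV[R]_n | [set 1] `|v|].
have [c c0 Sc] : exists2 c : R, 0 < c & forall x, S x -> c <= `|x|.
  have : nbhs (0 : X) (~` S).
    apply: open_nbhs_nbhs; split.
      apply: closed_openC; apply: compact_closed; first exact: norm_hausdorff.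
      apply/cptI/cptB; last by exists 1 => r /= ->.
      exact: closed_eq.
    move=> [v /= v1 r0].
    have v0 : v = 0.
      by rewrite -[v]combK r0; apply/rowP => i; rewrite !mxE linear0.
    by move: v1; rewrite v0 normr0 => /esym/eqP; rewrite oner_eq0.
  move=> /nbhs_norm0P[c /= c0 cS]; exists c => // x Sx.
  by rewrite leNgt; apply/negP => /cS; apply.
exists (comb @` [set v : 'rV[R]_n | [set r | r <= M / c] `|v|]).
  apply/cptI/cptB; last by exists (M / c).
  exact: closed_le.
move=> x xM; exists (crd x); last exact: crdK.
rewrite /= ler_pdivlMr//; apply: le_trans xM.
have [->|v0] := eqVneq (crd x) 0; first by rewrite normr0 mul0r.
have n0 : 0 < `|crd x| by rewrite normr_gt0.
suff : c <= `|(`|crd x|^-1 *: x)|.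
  by rewrite normrZ normfV normr_id [_^-1 * _]mulrC ler_pdivlMr// [c * _]mulrC.
apply: Sc; exists (`|crd x|^-1 *: crd x) => /=.
  by rewrite normrZ normfV normr_id mulVf ?gt_eqF.
rewrite -[X in _ = _ *: X](crdK x) /comb scaler_sumr.
by apply: eq_bigr => i _; rewrite mxE scalerA.
Qed.

Lemma bounded_cvg_subsequence (R : realType) (X : normedVectType R)
    (u : nat -> X) (M : R) : (forall k, `|u k| <= M) ->
  exists (n : nat -> nat) (w : X),
    n @ \oo --> \oo /\ u (n k) @[k --> \oo] --> w.
Proof.
move=> uM; have [K cK MK] := @closed_ball_sub_compact R X M.
have [w [_ clw]] : K `&` cluster (u @ \oo) !=set0.
  by apply: cK; exists 0%N => // k _; exact/MK.
have H k : exists n, (k <= n)%N /\ `|w - u n| < k.+1%:R^-1.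
  have k0 : 0 < k.+1%:R^-1 :> R by rewrite invr_gt0 ltr0Sn.
  have [|x [[n kn <-]]] :=
      clw (u @` [set n | (k <= n)%N]) _ _ (nbhsx_ballx w _ k0).
    by exists k => // n kn; exists n.
  by rewrite -ball_normE => wn; exists n.
have [n nP] := choice H.
exists n, w; split.
  move=> A [N _ NA]; exists N => // k /= Nk; apply: NA => /=.
  by apply: leq_trans Nk _; case: (nP k).
apply/cvgrPdist_lt => e e0.
have := @cvg_harmonic R => /cvgrPdist_lt/(_ e e0).
apply: filterS => k; rewrite sub0r normrN ger0_norm ?invr_ge0//.
by apply: lt_trans; case: (nP k).
Qed.

(** * Tangent and paratingent cones *)

(** Both the regular tangent cone and the paratingent cone are limits along
    this filter. *)
Lemma cvg_within_right0P (R : realType) (V : normedModType R) (Omega : set V)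
    (x : V) (p : nat -> V * R) :
  p @ \oo `=>` filter_prod (within Omega (nbhs x)) 0^'+ <->
  [/\ \forall k \near \oo, Omega (p k).1, (p k).1 @[k --> \oo] --> x,
      \forall k \near \oo, 0 < (p k).2 & (p k).2 @[k --> \oo] --> 0].
Proof.
split=> [pF|[pOm px p0 pz]].
  have p1 : (p k).1 @[k --> \oo] `=>` within Omega (nbhs x).
    exact: cvg_comp pF cvg_fst.
  have p2 : (p k).2 @[k --> \oo] `=>` 0^'+ by exact: cvg_comp pF cvg_snd.
  split.
  - by apply: (p1 Omega); exact: nearW.
  - by apply: cvg_trans p1 _; exact: cvg_within.
  - by apply: (p2 [set r | 0 < r]); exact: nbhs_right_gt.
  - by apply: cvg_trans p2 _; exact: cvg_within.
have p1 : (p k).1 @[k --> \oo] `=>` within Omega (nbhs x).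
  by move=> A /= /px; apply: filterS2 pOm => k pk; apply.
have p2 : (p k).2 @[k --> \oo] `=>` 0^'+.
  by move=> A /= /pz; apply: filterS2 p0 => k pk; apply.
have -> : p = (fun k => ((p k).1, (p k).2)) by apply/funext => k; case: (p k).
apply: (cvg_pair p1 p2).
Qed.

Lemma cvg_of_difference_quotient (R : realType) (V : normedModType R)
    (x z : nat -> V) (t : nat -> R) (a w : V) :
  x @ \oo --> a -> (forall k, 0 < t k) -> t @ \oo --> 0 ->
  (t k)^-1 *: (z k - x k) @[k --> \oo] --> w -> z @ \oo --> a.
Proof.
move=> xa t0 tz qw.
have -> : z = (fun k => x k + t k *: ((t k)^-1 *: (z k - x k))).
  apply/funext => k.
  by rewrite scalerA divff ?gt_eqF// scale1r addrC subrK.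
rewrite -[X in _ --> X]addr0 -[X in _ --> _ + X](scale0r w).
by apply: cvgD => //; exact: cvgZ.
Qed.

(** Dropping finitely many terms makes the conditions on the base points and on
    the step sizes hold for every index. *)
Lemma paratingent_coneP (R : realType) (V : normedModType R) (Omega : set V)
    (x w : V) : paratingent_cone Omega x w <->
  exists (xk zk : nat -> V) (t : nat -> R),
    [/\ forall k, [/\ Omega (xk k), Omega (zk k) & 0 < t k],
        xk @ \oo --> x, t @ \oo --> 0
      & (t k)^-1 *: (zk k - xk k) @[k --> \oo] --> w].
Proof.
split=> [[p [u [/cvg_within_right0P[pOm px p0 pz] pu uw]]]|].
  have [N _ NP] : \forall k \near \oo, Omega (p k).1 /\ 0 < (p k).2.
    by apply: filterS2 pOm p0.
  have pu' k : exists z, Omega z /\ (p k).2^-1 *: (z - (p k).1) = u k.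
    by have [z] := pu k; exists z.
  have [z zP] := choice pu'.
  have shift (T : topologicalType) (g : nat -> T) (l : T) :
      g @ \oo --> l -> g (k + N)%N @[k --> \oo] --> l.
    by move=> gl; apply: cvg_comp gl; exact: cvg_addnr.
  exists (fun k => (p (k + N)%N).1), (fun k => z (k + N)%N),
         (fun k => (p (k + N)%N).2); split.
  - move=> k; have [] := NP (k + N)%N (leq_addl k N).
    by split => //; case: (zP (k + N)%N).
  - exact: (shift _ (fun k => (p k).1)).
  - exact: (shift _ (fun k => (p k).2)).
  - apply: (shift _ (fun k => (p k).2^-1 *: (z k - (p k).1))).
    have -> // : (fun k => (p k).2^-1 *: (z k - (p k).1)) = u.
    by apply/funext => k; case: (zP k).
move=> [xk [zk [t [Om xx tz qw]]]].
exists (fun k => (xk k, t k)), (fun k => (t k)^-1 *: (zk k - xk k)); split => //.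
  by apply/cvg_within_right0P; split => //; apply: nearW => k; case: (Om k).
by move=> k; exists (zk k) => //; case: (Om k).
Qed.

Section linear_tangents.
Context {R : realType} {V : normedModType R}.
Implicit Types (Omega : set V) (x v w : V).

Lemma regular_tangent_cone0 Omega x : regular_tangent_cone Omega x 0.
Proof.
move=> p /cvg_within_right0P[pOm _ _ _].
exists (fun=> 0); split; last exact: cvg_cst.
by apply: filterS pOm => k pk; exists (p k).1 => //; rewrite subrr scaler0.
Qed.

Lemma regular_tangent_coneZ Omega x (c : R) v : 0 < c ->
  regular_tangent_cone Omega x v -> regular_tangent_cone Omega x (c *: v).
Proof.
move=> c0 vT p /cvg_within_right0P[pOm px p0 pz].
have [|u [uq uv]] := vT (fun k => ((p k).1, c * (p k).2)).
  apply/cvg_within_right0P; split => //.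
    by apply: filterS p0 => k pk; rewrite mulr_gt0.
  by rewrite -[X in _ --> X](mulr0 c); apply: cvgM => //; exact: cvg_cst.
exists (fun k => c *: u k); split; last exact: cvgZl_tmp.
apply: filterS uq => k [z zOm /= <-]; exists z => //.
by rewrite invfM scalerA mulrA divff ?mul1r ?gt_eqF.
Qed.

(** Convexity of the regular tangent cone: moving from the base points along
    [v] yields base points in [Omega] with the same limit, and from these one
    can move along [w]. *)
Lemma regular_tangent_coneD Omega x v w :
  regular_tangent_cone Omega x v -> regular_tangent_cone Omega x w ->
  regular_tangent_cone Omega x (v + w).
Proof.
move=> vT wT p /[dup] pF /cvg_within_right0P[pOm px p0 pz].
have [u [uq uv]] := vT p pF.
have [|u' [uq' uw]] := wT (fun k => ((p k).1 + (p k).2 *: u k, (p k).2)).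
  apply/cvg_within_right0P; split => //.
    apply: filterS2 p0 uq => k pk [z zOm /= <-].
    by rewrite scalerA divff ?gt_eqF// scale1r addrC subrK.
  rewrite -[X in _ --> X]addr0 -[X in _ --> _ + X](scale0r v).
  by apply: cvgD => //; exact: cvgZ.
exists (u \+ u'); split; last exact: cvgD.
apply: filterS2 p0 uq' => k pk [z zOm /= <-]; exists z => //=.
rewrite opprD addrA [in RHS]scalerBr [in RHS]scalerA mulVf ?gt_eqF// scale1r.
by rewrite [RHS]addrC subrK.
Qed.

(** In a paratingent difference quotient both end points lie in [Omega], so they
    may be exchanged. *)
Lemma paratingent_coneN Omega x v :
  paratingent_cone Omega x v -> paratingent_cone Omega x (- v).
Proof.
move=> /paratingent_coneP[xk [zk [t [Om xx tz qv]]]].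
apply/paratingent_coneP; exists zk, xk, t; split => //.
- by move=> k; case: (Om k).
- by apply: cvg_of_difference_quotient xx _ tz qv => k; case: (Om k).
- under eq_fun do rewrite -opprB scalerN.
  exact: cvgN.
Qed.

(** The common cone inherits convexity from the regular tangent cone and
    symmetry from the paratingent cone, so it is a subspace. *)
Lemma regular_eq_paratingent_linear Omega x (a : R) v w :
  regular_tangent_cone Omega x = paratingent_cone Omega x ->
  regular_tangent_cone Omega x v -> regular_tangent_cone Omega x w ->
  regular_tangent_cone Omega x (a *: v + w).
Proof.
move=> E vT wT; apply: regular_tangent_coneD => //.
have [a0|a0|->] := ltgtP a 0.
- rewrite -[a]opprK scaleNr E; apply: paratingent_coneN; rewrite -E.
  by apply: regular_tangent_coneZ; rewrite ?oppr_gt0.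
- exact: regular_tangent_coneZ.
- by rewrite scale0r; exact: regular_tangent_cone0.
Qed.

End linear_tangents.

(** * Continuity of the inner product *)

Section dot.
Context {R : realType} {X : normedVectType R} (ip : {dot X for idfun}).
Context (norm_ip : forall x : X, `|x| = Num.sqrt (ip x x)).

Lemma ip_sqr x : ip x x = `|x| ^+ 2.
Proof.
rewrite norm_ip sqr_sqrtr//.
have [->|x0] := eqVneq x 0; first by rewrite linear0l.
by apply/ltW/neq0_dnorm_gt0.
Qed.

(** Polarization reduces continuity of the inner product to that of the
    norm. *)
Lemma ip_polar x y : ip x y = (`|x + y| ^+ 2 - `|x - y| ^+ 2) / 4.
Proof.
have C : ip y x = ip x y by rewrite hermC /= expr0 mul1r.
have Dl a b c : ip (a + b) c = ip a c + ip b c by rewrite linearDl.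
have Dr a b c : ip a (b + c) = ip a b + ip a c by rewrite linearDr.
have Nl a b : ip (- a) b = - ip a b by rewrite linearNl.
have Nr a b : ip a (- b) = - ip a b by rewrite linearNr.
by rewrite -!ip_sqr !(Dl, Dr, Nl, Nr) C; lra.
Qed.

Lemma cvg_ip (x y : nat -> X) (a b : X) : x @ \oo --> a -> y @ \oo --> b ->
  ip (x k) (y k) @[k --> \oo] --> ip a b.
Proof.
move=> xa yb; rewrite ip_polar.
under eq_fun do rewrite ip_polar.
apply: cvgM; last exact: cvg_cst.
apply: cvgB; rewrite !expr2; apply: cvgM; apply: cvg_norm.
all: by [apply: cvgD|apply: cvgB].
Qed.

End dot.

(** * Linear algebra on the graph space *)

(** [L] embeds into [X] by [p |-> p.1 + c *: p.2], hence has at most the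
    dimension of [X], and a linear map from [L] onto [X] must then be injective.
    The proof avoids turning [L] into a vector space: a linear right inverse
    [S] of the onto map, followed by the embedding, is an injective endomorphism
    of [X], so it is onto and [S] reaches every element of [L]. *)
Lemma subspace_kernel_trivial (K : fieldType) (X : vectType K)
    (L : set (X * X)) (A : {linear X -> X}) (c : K) :
  (forall a p q, L p -> L q -> L (a *: p + q)) ->
  (forall p, L p -> p.1 + c *: p.2 = 0 -> p = 0) ->
  (forall y, exists2 p, L p & A p.1 + p.2 = y) ->
  forall p, L p -> A p.1 + p.2 = 0 -> p = 0.
Proof.
move=> Llin Linj Lsur p Lp Ap.
have Lsur' y : exists q, L q /\ A q.1 + q.2 = y.
  by have [q] := Lsur y; exists q.
have [g gP] := choice Lsur'.
pose b := vbasis {:X}.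
pose S (y : X) : X * X := \sum_i coord b i y *: g b`_i.
have LS y : L (S y).
  apply: big_ind => [|q q' Lq Lq'|i _].
  - by rewrite -(addNr p) -scaleN1r; apply/Llin.
  - by rewrite -[q]scale1r; apply/Llin.
  - rewrite -[_ *: _]addr0; apply/Llin; first by case: (gP b`_i).
    by rewrite -(addNr p) -scaleN1r; apply/Llin.
have AS y : A (S y).1 + (S y).2 = y.
  rewrite [RHS](coord_vbasis (memvf y)) !raddf_sum /= -big_split /=.
  apply: eq_bigr => i _.
  by rewrite linearZ -scalerDr; have [_ ->] := gP b`_i.
have Slin : linear S.
  move=> a y y'; rewrite scaler_sumr -big_split /=; apply: eq_bigr => i _.
  by rewrite linearP scalerDl scalerA.
pose m (y : X) : X := (S y).1 + c *: (S y).2.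
have mlin : linear m.
  by move=> a y y'; rewrite /m Slin /= !scalerDr !scalerA mulrC addrACA.
pose M : {linear X -> X} := HB.pack m (GRing.isLinear.Build _ _ _ _ m mlin).
have kM : lker (linfun M) == 0%VS.
  apply/eqP/vspaceP => y; rewrite memv_ker memv0 lfunE /=.
  apply/eqP/eqP => [my0|->]; last by rewrite [LHS](linear0 M).
  by rewrite -(AS y) (Linj _ (LS y) my0) linear0 addr0.
have [y yP] : exists y, m y = p.1 + c *: p.2.
  exists ((linfun M)^-1%VF (p.1 + c *: p.2)).
  by rewrite -[RHS](lker0_lfunVK kM) lfunE.
have pS : p = S y.
  apply/eqP; rewrite -subr_eq0; apply/eqP/Linj.
    by rewrite addrC -scaleN1r; apply/Llin.
  by rewrite /= scalerBr addrACA -opprD -yP subrr.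
by rewrite pS -[y]AS -pS Ap /S big1// => i _; rewrite linear0 scale0r.
Qed.

(** * Adding a strictly differentiable map *)

Section paratingent_map.
Context {R : realType}.

Lemma strictly_differentiable_cvg (V W : normedModType R) (psi : V -> W)
    (xb d : V) (x z : nat -> V) (t : nat -> R) :
  strictly_differentiable psi xb ->
  x @ \oo --> xb -> z @ \oo --> xb -> (forall k, 0 < t k) ->
  (t k)^-1 *: (z k - x k) @[k --> \oo] --> d ->
  (t k)^-1 *: (psi (z k) - psi (x k)) @[k --> \oo] --> 'd psi xb d.
Proof.
move=> [dpsi spsi] xx zx t0 qd.
have Dq : 'd psi xb ((t k)^-1 *: (z k - x k)) @[k --> \oo] --> 'd psi xb d.
  by apply: cvg_comp qd _; exact: diff_continuous.
apply: cvg_sub0 Dq.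
have M0 : 0 < `|d| + 1 by rewrite ltr_wpDl.
apply/cvgrPdist_le => e e0.
have c0 : 0 < e / (`|d| + 1) by rewrite divr_gt0.
have bnd : \forall k \near \oo, `|(t k)^-1 *: (z k - x k)| < `|d| + 1.
  by apply: (cvgr_norm_lt d qd); rewrite ltrDl.
have err := cvg_pair zx xx (spsi _ c0); rewrite /= in err.
near=> k; rewrite sub0r normrN !fctE.
have -> : (t k)^-1 *: (psi (z k) - psi (x k)) -
    'd psi xb ((t k)^-1 *: (z k - x k)) =
    (t k)^-1 *: (psi (z k) - psi (x k) - 'd psi xb (z k - x k)).
  by rewrite linearZ [RHS]scalerBr.
have tk0 : 0 <= (t k)^-1 by rewrite invr_ge0 ltW.
rewrite normrZ ger0_norm//.
apply: (@le_trans _ _ (e / (`|d| + 1) * `|(t k)^-1 *: (z k - x k)|)).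
  rewrite normrZ ger0_norm// mulrCA ler_wpM2l//.
  near: k; exact: err.
rewrite mulrAC ler_pdivrMr// ler_wpM2l ?ltW//.
by near: k; exact: bnd.
Unshelve. all: by end_near. Qed.

(** The sum rule for paratingent cones: the shear [(x, y) |-> (x, y - psi x)]
    maps the graph of [psi + F] to that of [F] and acts on directions through
    its strict derivative. *)
Lemma paratingent_cone_gph_add (V W : normedModType R) (psi : V -> W)
    (F : V -> set W) (xb d : V) (yb e : W) :
  strictly_differentiable psi xb ->
  paratingent_cone (gph (fun x => [set psi x + v | v in F x])) (xb, yb) (d, e) ->
  paratingent_cone (gph F) (xb, yb - psi xb) (d, e - 'd psi xb d).
Proof.
move=> spsi /paratingent_coneP[p [q [t [Om pp tz tq]]]].
have t0 k : 0 < t k by case: (Om k).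
have qp := cvg_of_difference_quotient pp t0 tz tq.
have p1 : (p k).1 @[k --> \oo] --> xb by exact: (cvg_comp _ _ pp cvg_fst).
have p2 : (p k).2 @[k --> \oo] --> yb by exact: (cvg_comp _ _ pp cvg_snd).
have q1 : (q k).1 @[k --> \oo] --> xb by exact: (cvg_comp _ _ qp cvg_fst).
have d1 : (t k)^-1 *: ((q k).1 - (p k).1) @[k --> \oo] --> d.
  exact: (cvg_comp _ _ tq cvg_fst).
have d2 : (t k)^-1 *: ((q k).2 - (p k).2) @[k --> \oo] --> e.
  exact: (cvg_comp _ _ tq cvg_snd).
have dpsi := strictly_differentiable_cvg spsi p1 q1 t0 d1.
apply/paratingent_coneP.
exists (fun k => ((p k).1, (p k).2 - psi (p k).1)),
       (fun k => ((q k).1, (q k).2 - psi (q k).1)), t; split => //.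
- have FE (r : V * W) : gph (fun x => [set psi x + v | v in F x]) r ->
      gph F (r.1, r.2 - psi r.1).
    by move=> [v Fv <-]; rewrite /gph/= addrAC subrr add0r.
  by move=> k; have [/FE pk /FE qk] := Om k.
- apply: cvg_pair => //; apply: cvgB => //.
  apply: cvg_comp p1 _; apply: differentiable_continuous.
  by case: spsi.
have -> : (fun k => (t k)^-1 *: (((q k).1, (q k).2 - psi (q k).1) -
      ((p k).1, (p k).2 - psi (p k).1))) =
    (fun k => ((t k)^-1 *: ((q k).1 - (p k).1),
      (t k)^-1 *: ((q k).2 - (p k).2) -
      (t k)^-1 *: (psi (q k).1 - psi (p k).1))).
  apply/funext => k; congr pair => /=; rewrite -scalerBr; congr (_ *: _).
  by rewrite !opprB addrACA [RHS]addrACA; congr (_ + _); rewrite addrC.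
by apply: cvg_pair => //; exact: cvgB.
Qed.

End paratingent_map.

(** * Hypomonotonicity from prox-regularity *)

Section prox.
Context {R : realType} {X : normedVectType R} (ip : {dot X for idfun}).
Context (norm_ip : forall x : X, `|x| = Num.sqrt (ip x x)).

(** Adding the two subgradient inequalities at [x] and [x'] cancels the values
    of [f]. *)
Lemma prox_regular_sub_monotone (f : X -> \bar R) (xb vb : X) :
  prox_regular ip f xb vb ->
  exists e r : R, [/\ 0 < e, 0 <= r & forall x v x' v',
    subdifferential ip f x v -> subdifferential ip f x' v' ->
    `|(x, v) - (xb, vb)| <= e -> `|(x', v') - (xb, vb)| <= e ->
    (f x < f xb + e%:E)%E -> (f x' < f xb + e%:E)%E ->
    - r * `|x' - x| ^+ 2 <= ip (v' - v) (x' - x)].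
Proof.
move=> [_ _ _ [e [r [e0 r0 P]]]]; exists e, r; split => // x v x' v' fxv fxv'.
move=> xe xe' fx fx'.
have ne (y w : X) : `|(y, w) - (xb, vb)| <= e -> `|y - xb| <= e.
  by apply: le_trans; rewrite prod_normE /= le_max lexx.
have := P _ _ x' fxv xe fx (ne _ _ xe').
have := P _ _ x fxv' xe' fx' (ne _ _ xe).
have [fin _] := fxv; have [fin' _] := fxv'.
rewrite -(fineK fin) -(fineK fin') -!EFinD !lee_fin.
rewrite -(opprB x' x) normrN (linearNr ip) (linearBl ip) /=.
set a := ip v' _; set b := ip v _; set N := `|_| ^+ 2.
by move=> h1 h2; lra.
Qed.

(** Divide the monotonicity inequality by [t ^+ 2] and pass to the limit.
    Subdifferential continuity gives the bounds on the values of [f] that the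
    inequality requires. *)
Lemma prox_regular_paratingent (f : X -> \bar R) (xb vb : X) :
  prox_regular ip f xb vb -> subdifferentially_continuous ip f xb vb ->
  exists2 r : R, 0 <= r &
    forall u w, paratingent_cone (gph (subdifferential ip f)) (xb, vb) (u, w) ->
      - r * `|u| ^+ 2 <= ip w u.
Proof.
move=> prf scf; have [fin _ _ _] := prf.
have [e [r [e0 r0 mono]]] := prox_regular_sub_monotone prf.
exists r => // u w /paratingent_coneP[p [q [t [Om pp tz tq]]]].
have t0 k : 0 < t k by case: (Om k).
have qp := cvg_of_difference_quotient pp t0 tz tq.
have close (g : nat -> X * X) :
    (forall k, gph (subdifferential ip f) (g k)) -> g @ \oo --> (xb, vb) ->
    \forall k \near \oo, `|((g k).1, (g k).2) - (xb, vb)| <= e /\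
      (f (g k).1 < f xb + e%:E)%E.
  move=> Og gg.
  have fg : f (g k).1 @[k --> \oo] --> f xb.
    apply: (scf (fun k => (g k).1) (fun k => (g k).2)) => //.
      exact: (cvg_comp _ _ gg cvg_fst).
    exact: (cvg_comp _ _ gg cvg_snd).
  have flt : nbhs (f xb) [set y | (y < f xb + e%:E)%E].
    apply: open_nbhs_nbhs; split; first exact: open_ereal_lt_ereal.
    by rewrite /= lteDl.
  have flt' : \forall k \near \oo, (f (g k).1 < f xb + e%:E)%E.
    exact: fg flt.
  have ge : \forall k \near \oo, `|(xb, vb) - g k| <= e.
    exact: (@cvgr_dist_le _ _ _ _ _ g _ gg _ e0).
  apply: filterS2 flt' ge => k fk; rewrite distrC => gk.
  by split => //; move: gk; case: (g k).
have u_ : (t k)^-1 *: ((q k).1 - (p k).1) @[k --> \oo] --> u.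
  exact: (cvg_comp _ _ tq cvg_fst).
have w_ : (t k)^-1 *: ((q k).2 - (p k).2) @[k --> \oo] --> w.
  exact: (cvg_comp _ _ tq cvg_snd).
have n_ : - r * (`|(t k)^-1 *: ((q k).1 - (p k).1)| ^+ 2)
    @[k --> \oo] --> - r * `|u| ^+ 2.
  apply: cvgM; first exact: cvg_cst.
  by apply: (cvgM (cvg_norm u_) (cvg_norm u_)).
apply: (ler_cvg_to n_ (cvg_ip norm_ip w_ u_)).
have cp := close p (fun k => let: And3 pk _ _ := Om k in pk) pp.
have cq := close q (fun k => let: And3 _ qk _ := Om k in qk) qp.
apply: filterS2 cp cq => k [pe fp] [qe fq].
have [pk qk tk] := Om k.
have tk2 : 0 <= (t k)^-1 ^+ 2 by rewrite exprn_ge0// invr_ge0 ltW.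
have := ler_wpM2l tk2 (mono _ _ _ _ pk qk pe qe fp fq).
rewrite normrZ exprMn real_normK ?num_real//.
rewrite (linearZr_LR ip) (linearZl_LR ip) /=; lra.
Qed.

End prox.

(** * Metric regularity through cones *)

Section regularity.
Context {R : realType}.

Lemma edist_norm (V : normedModType R) (x y : V) :
  edist (x, y) = `|x - y|%:E.
Proof.
apply/le_anti/andP; split.
  apply/lee_addgt0Pr => e e0; rewrite -EFinD; apply: edist_fin.
    by rewrite ltr_wpDl.
  by rewrite -ball_normE /ball_ /= ltrDl.
rewrite leNgt; apply/negP => /edist_lt_ball.
by rewrite -ball_normE /ball_ /= ltxx.
Qed.

(** Read the regularity estimate at [xb], where the distance from [y] to
    [F xb] is at most [`|y - yb|]. The constant grows by one because the
    distance to the inverse image need not be attained. *)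
Lemma metrically_regular_solvable (V W : normedModType R) (F : V -> set W)
    (xb : V) (yb : W) : metrically_regular F xb yb ->
  exists2 K : R, 0 < K &
    \forall y \near yb, exists2 x, F x y & `|x - xb| <= K * `|y - yb|.
Proof.
move=> [Fb [k [U [N [k0 /nbhs_singleton Ub Nb reg]]]]].
exists (k + 1); first by rewrite addr_gt0.
apply: filterS Nb => y /(reg _ _ Ub) dxy.
have [->|yyb] := eqVneq y yb; first by exists xb; rewrite // !subrr !normr0 mulr0.
have lt_y : (edist_inf (setval_inv F y) xb < ((k + 1) * `|y - yb|)%:E)%E.
  apply: le_lt_trans dxy _.
  apply: (@le_lt_trans _ _ (k%:E * `|y - yb|%:E)%E).
    apply: lee_wpmul2l; first by rewrite lee_fin ltW.
    by rewrite -edist_norm; apply: ereal_inf_lbound; exists yb.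
  by rewrite -EFinM lte_fin ltr_pM2r ?normr_gt0 ?subr_eq0// ltrDl.
have [_ [x Fxy <-]] := ereal_inf_lt lt_y.
rewrite edist_norm lte_fin => xxb.
by exists x => //; rewrite distrC ltW.
Qed.

(** If some [y'] in [F x] is close to [yb] then [x = s y'] and the Lipschitz
    estimate applies. Otherwise [y'] is far from [y], while [x] and [s y] are
    both close to [xb], so a large constant suffices. *)
Lemma strongly_metrically_regularW (V W : normedModType R) (F : V -> set W)
    (xb : V) (yb : W) :
  strongly_metrically_regular F xb yb -> metrically_regular F xb yb.
Proof.
move=> [Fb [U [N [s [Ub Nb sP slip]]]]]; split => //.
have [M /= M0 sM] : exists2 M : R, 0 < M &
    forall y y', N y -> N y' -> `|s y - s y'| <= M * `|y - y'|.
  have [M M0 sM] := pinfty_ex_gt0 slip; exists M => // y y' Ny Ny'.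
  exact: (sM (y, y')).
have /nbhs_ballP[e /= e0 eU] := Ub.
have /nbhs_ballP[d /= d0 dN] := Nb.
(* [M] serves the values [y'] within [d] of [yb]; for the others
   [`|y - y'| >= d / 2], and [2 * e / d] absorbs [`|x - xb| < e]. *)
have kd : 0 < M + 2 * e / d by rewrite addr_gt0// divr_gt0// mulr_gt0.
exists (M + 2 * e / d), (ball xb e), (ball yb (d / 2)); split => //.
- exact: nbhsx_ballx.
- by apply: nbhsx_ballx; rewrite divr_gt0.
move=> x y xe ye.
have sub y' : N y' -> forall x, U x -> F x y' -> x = s y'.
  by move=> Ny' x' Ux' Fx'; have := sP _ Ny'; move/seteqP => [+ _]; apply.
have Fs y' : N y' -> F (s y') y'.
  by move=> Ny'; have /seteqP[_ /(_ _ erefl)[]] := sP _ Ny'.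
have Ny : N y.
  by apply: dN; apply: le_ball ye; lra.
have sb : xb = s yb by apply: sub => //; exact: nbhs_singleton.
rewrite muleC -lee_pdivrMr//.
apply: le_ereal_inf_tmp => _ [y' Fxy' <-].
rewrite lee_pdivrMr//.
apply: (@le_trans _ _ (edist (x, s y))).
  by apply: ereal_inf_lbound; exists (s y) => //; exact: Fs.
rewrite !edist_norm -EFinM lee_fin.
have n0 : 0 <= `|y - y'| by [].
have [y'd|y'd] := ltP `|yb - y'| d.
  have Ny' : N y' by apply: dN; rewrite -ball_normE.
  rewrite (sub _ Ny' _ (eU _ xe) Fxy').
  apply: le_trans (sM _ _ Ny' Ny) _; rewrite distrC mulrC ler_wpM2l// lerDl.
  by rewrite divr_ge0 ?mulr_ge0 ?ltW.
move: xe ye; rewrite -!ball_normE /ball_/= => xe ye.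
have yy' : d / 2 <= `|y - y'|.
  by have := ler_distD y yb y'; lra.
have sy : `|xb - s y| <= M * `|yb - y|.
  by rewrite {1}sb; apply: sM => //; exact: nbhs_singleton.
have := ler_distD xb x (s y); rewrite (distrC x xb) => tri.
have h1 : M * `|yb - y| <= M * `|y - y'| by apply: ler_wpM2l; lra.
have h2 : e <= 2 * e / d * `|y - y'|.
  apply: (@le_trans _ _ (2 * e / d * (d / 2))); last first.
    by apply: ler_wpM2l => //; rewrite divr_ge0 ?mulr_ge0 ?ltW.
  by rewrite le_eqVlt; apply/orP; left; apply/eqP; field; rewrite gt_eqF.
by lra.
Qed.

(** Solve [F x = yb + t e] for small [t]: the rescaled solutions
    [(x - xb) / t] are bounded and accumulate at the wanted [d]. *)
Lemma solvable_paratingent_onto (X : normedVectType R) (W : normedModType R)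
    (F : X -> set W) (xb : X) (yb : W) (K : R) : F xb yb ->
  (\forall y \near yb, exists2 x, F x y & `|x - xb| <= K * `|y - yb|) ->
  forall e, exists d, paratingent_cone (gph F) (xb, yb) (d, e).
Proof.
move=> Fb sol e.
pose y (k : nat) := yb + k.+1%:R^-1 *: e.
have y_yb : y @ \oo --> yb.
  rewrite -[X in _ --> X]addr0 -[X in _ --> _ + X](scale0r e).
  apply: cvgD; first exact: cvg_cst.
  by apply: cvgZr_tmp; exact: cvg_harmonic.
have [N _ NP] := y_yb _ sol.
have sol' k : exists x, F x (y (N + k)%N) /\ `|x - xb| <= K * `|y (N + k)%N - yb|.
  by have [x] := NP (N + k)%N (leq_addr _ _); exists x.
have [x xP] := choice sol'.
pose t k : R := (N + k).+1%:R^-1.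
have t0 k : 0 < t k by rewrite invr_gt0.
have tz : t @ \oo --> 0.
  by apply: (cvg_comp _ _ _ (@cvg_harmonic R)); exact: cvg_addnl.
have yt k : y (N + k)%N - yb = t k *: e by rewrite /y addrAC subrr add0r.
have [k|n [d [noo nd]]] :=
    @bounded_cvg_subsequence _ _ (fun k => (t k)^-1 *: (x k - xb)) (K * `|e|).
  have [_] := xP k; rewrite yt normrZ gtr0_norm// => xk.
  by rewrite normrZ normfV gtr0_norm// ler_pdivrMl// mulrCA.
exists d; apply/paratingent_coneP.
exists (fun=> (xb, yb)), (fun k => (x (n k), y (N + n k)%N)),
  (fun k => t (n k)); split => //.
- by move=> k; split => //; case: (xP (n k)).
- exact: cvg_cst.
- exact: cvg_comp noo tz.
have -> : (fun k => (t (n k))^-1 *: ((x (n k), y (N + n k)%N) - (xb, yb))) =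
    (fun k => ((t (n k))^-1 *: (x (n k) - xb), e)).
  apply/funext => k; congr pair => /=.
  by rewrite yt scalerA mulVf ?gt_eqF// scale1r.
by apply: cvg_pair => //; exact: cvg_cst.
Qed.

(** If no Lipschitz estimate held, pairs of graph points tending to [(xb, yb)]
    would have second components closer and closer relative to the first ones;
    normalizing the differences of the first components and extracting a
    subsequence gives a unit vector [d] with [(d, 0)] in the cone. *)
Lemma paratingent_kernel_lipschitz (X : normedVectType R) (W : normedModType R)
    (F : X -> set W) (xb : X) (yb : W) :
  (forall d, paratingent_cone (gph F) (xb, yb) (d, 0) -> d = 0) ->
  exists e l : R, [/\ 0 < e, 0 < l & forall x x' y y', F x y -> F x' y' ->
    `|x - xb| < e -> `|x' - xb| < e -> `|y - yb| < e -> `|y' - yb| < e ->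
    `|x - x'| <= l * `|y - y'|].
Proof.
move=> ker; apply: contrapT => nlip.
have bad (k : nat) : exists p : (X * W) * (X * W),
    [/\ gph F p.1, gph F p.2, `|p.1 - (xb, yb)| < k.+1%:R^-1,
      `|p.2 - (xb, yb)| < k.+1%:R^-1 &
      k.+1%:R * `|p.2.2 - p.1.2| < `|p.2.1 - p.1.1|].
  apply: contrapT => nP; apply: nlip.
  exists k.+1%:R^-1, k.+1%:R; split; rewrite ?invr_gt0// => x x' y y' Fxy Fxy'.
  move=> xe xe' ye ye'; rewrite leNgt; apply/negP => lt; apply: nP.
  by exists ((x', y'), (x, y)); split => //=; rewrite prod_normE gt_max /= ?xe ?xe'.
have [p pP] := choice bad.
pose t k := `|(p k).2.1 - (p k).1.1|.
have t0 k : 0 < t k.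
  by have [_ _ _ _] := pP k; apply: le_lt_trans; rewrite mulr_ge0.
have to_b (g : nat -> X * W) : (forall k, `|g k - (xb, yb)| < k.+1%:R^-1) ->
    g @ \oo --> (xb, yb).
  move=> gb; apply/cvgrPdist_lt => e e0.
  have := @cvg_harmonic R => /cvgrPdist_lt/(_ e e0).
  apply: filterS => k; rewrite sub0r normrN ger0_norm ?invr_ge0//.
  by apply: lt_trans; rewrite distrC.
have p1 : (p k).1 @[k --> \oo] --> (xb, yb) by apply: to_b => k; case: (pP k).
have p2 : (p k).2 @[k --> \oo] --> (xb, yb) by apply: to_b => k; case: (pP k).
have tz : t @ \oo --> 0.
  rewrite -(normr0 X) -(subrr xb); apply: cvg_norm; apply: cvgB.
    exact: (cvg_comp _ _ p2 cvg_fst).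
  exact: (cvg_comp _ _ p1 cvg_fst).
pose q k := (t k)^-1 *: ((p k).2.1 - (p k).1.1).
have q1 k : `|q k| = 1.
  by rewrite normrZ normfV normr_id mulVf// gt_eqF// t0.
have [k|n [d [noo nd]]] := @bounded_cvg_subsequence _ _ q 1; first by rewrite q1.
have d1 : `|d| = 1.
  apply: (cvg_unique _ (cvg_norm nd)) => //.
  have -> : (fun k => `|q (n k)|) = (fun=> 1) by apply/funext => k; exact: q1.
  exact: cvg_cst.
suff /ker d0 : paratingent_cone (gph F) (xb, yb) (d, 0).
  by move: d1; rewrite d0 normr0 => /eqP; rewrite eq_sym oner_eq0.
apply/paratingent_coneP.
exists (fun k => (p (n k)).1), (fun k => (p (n k)).2), (fun k => t (n k)).
split.
- by move=> k; split => //; case: (pP (n k)).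
- exact: (cvg_comp _ _ noo p1).
- exact: (cvg_comp _ _ noo tz).
have w0 : (t k)^-1 *: ((p k).2.2 - (p k).1.2) @[k --> \oo] --> 0.
  apply/cvgrPdist_lt => e e0.
  have := @cvg_harmonic R => /cvgrPdist_lt/(_ e e0).
  apply: filterS => k; rewrite !sub0r !normrN ger0_norm ?invr_ge0//.
  apply: le_lt_trans; rewrite normrZ normfV normr_id.
  have [_ _ _ _ /ltW] := pP k.
  by rewrite -/(t k) ler_pdivrMl// mulrC ler_pdivlMr// mulrC.
exact: (cvg_pair nd (cvg_comp _ _ noo w0)).
Qed.

(** Solvability gives the values of the localization of the inverse; the
    estimate gives their uniqueness (take [y = y']) and Lipschitz continuity. *)
Lemma strongly_metrically_regular_of_lipschitz (V W : normedModType R)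
    (F : V -> set W) (xb : V) (yb : W) (K e l : R) :
  F xb yb -> 0 < K -> 0 < e ->
  (\forall y \near yb, exists2 x, F x y & `|x - xb| <= K * `|y - yb|) ->
  (forall x x' y y', F x y -> F x' y' ->
    `|x - xb| < e -> `|x' - xb| < e -> `|y - yb| < e -> `|y' - yb| < e ->
    `|x - x'| <= l * `|y - y'|) ->
  strongly_metrically_regular F xb yb.
Proof.
move=> Fb K0 e0 /nbhs_normP[d /= d0 sol] lip; split => //.
(* [e / K] keeps the solutions within [e] of [xb]. *)
pose rho := Num.min d (Num.min e (e / K)).
have rho0 : 0 < rho by rewrite !lt_min d0 e0 divr_gt0.
pose N := [set y | `|y - yb| < rho].
have sol' y : exists x, N y -> F x y /\ `|x - xb| < e.
  have [Ny|nNy] := pselect (N y); last by exists xb.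
  have := Ny; rewrite /N /= !lt_min => /and3P[yd _ yK].
  have [|x Fxy xK] := sol y; first by rewrite /= distrC.
  exists x => _; split => //; apply: le_lt_trans xK _.
  by rewrite mulrC -ltr_pdivlMr.
have [s sP] := choice sol'.
have Ne y : N y -> `|y - yb| < e by rewrite /N /= !lt_min => /and3P[].
exists [set x | `|x - xb| < e], N, s; split.
- by apply/nbhs_normP; exists e => // x /=; rewrite distrC.
- by apply/nbhs_normP; exists rho => // y /=; rewrite distrC.
- move=> y Ny; have [Fs se] := sP _ Ny; apply/seteqP; split=> [x [Fx xe]|x ->//].
  have := lip _ _ _ _ Fx Fs xe se (Ne _ Ny) (Ne _ Ny).
  by rewrite subrr normr0 mulr0 normr_le0 subr_eq0 => /eqP.
- have NN : ProperFilter (globally (N `*` N)).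
    by apply: (@globally_properfilter _ _ (yb, yb)); rewrite /N /= subrr normr0.
  apply: (@klipschitzW _ _ _ l) => -[y y'] [/= Ny Ny'].
  have [[Fs se] [Fs' se']] := (sP _ Ny, sP _ Ny').
  by apply: lip => //; exact: Ne.
Qed.

End regularity.

(** * Equivalence of the two regularity properties *)

Theorem corollary4p4 (R : realType) (X : normedVectType R)
    (ip : {dot X for idfun})
    (norm_ip : forall x : X, `|x| = Num.sqrt (ip x x))
    (psi : X -> X) (f : X -> \bar R) (xb : X)
    (psi_diff : forall x, differentiable psi x)
    (f_proper : proper_function f)
    (G := fun x : X => [set psi x + v | v in subdifferential ip f x])
    (G_xb : G xb 0)
    (psi_sdiff : strictly_differentiable psi xb)
    (f_prox : prox_regular ip f xb (- psi xb))
    (f_sc : subdifferentially_continuous ip f xb (- psi xb))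
    (f_proto :
       strictly_proto_differentiable (subdifferential ip f) xb (- psi xb)) :
  metrically_regular G xb 0 <-> strongly_metrically_regular G xb 0.
Proof.
split; last exact: strongly_metrically_regularW.
move=> /metrically_regular_solvable[K K0 sol].
have [_ regE] := f_proto.
pose L := paratingent_cone (gph (subdifferential ip f)) (xb, - psi xb).
have Llin a p q : L p -> L q -> L (a *: p + q).
  by rewrite /L -regE; exact: regular_eq_paratingent_linear.
have [r r0 mono] := prox_regular_paratingent norm_ip f_prox f_sc.
have rD u w : paratingent_cone (gph G) (xb, 0) (u, w) -> L (u, w - 'd psi xb u).
  by move/(paratingent_cone_gph_add psi_sdiff); rewrite sub0r.
have [d|e [l [e0 l0 lip]]] := @paratingent_kernel_lipschitz _ _ _ G xb 0; last first.
  exact: strongly_metrically_regular_of_lipschitz sol lip.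
move=> /rD Ld.
suff ker : forall p, L p -> 'd psi xb p.1 + p.2 = 0 -> p = 0.
  have kd : 'd psi xb d + (0 - 'd psi xb d) = 0 by rewrite sub0r subrr.
  by have [] := ker _ Ld kd.
apply: (@subspace_kernel_trivial _ _ L ('d psi xb) (r + 1)^-1) => //.
- move=> [u w] /mono /= uw uw0.
  have r1 : 0 < r + 1 by rewrite ltr_wpDl.
  (* On the kernel of [u + c w] the vector [w] is [- (r + 1) u], so the
     hypomonotonicity bound reads [- r |u|^2 <= - (r + 1) |u|^2]. *)
  have wE : w = - ((r + 1) *: u).
    apply/eqP; rewrite -addr_eq0 addrC -[w](scalerKV (lt0r_neq0 r1)) -scalerDr.
    by rewrite uw0 scaler0.
  move: uw; rewrite wE (linearNl ip) (linearZl_LR ip) /= (ip_sqr norm_ip) => uw.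
  have u0 : `|u| ^+ 2 <= 0 by lra.
  have -> : u = 0.
    by apply/eqP; rewrite -normr_eq0 -sqrf_eq0 eq_le u0 sqr_ge0.
  by rewrite scaler0 oppr0.
- move=> y; have [u uP] := solvable_paratingent_onto G_xb sol y.
  by exists (u, y - 'd psi xb u); [exact: rD|rewrite /= addrC subrK].
Qed.
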